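(* Let $(\mathcal M,\mathcal E)$ be a MAC grid of $\Omega$, let $\rho^n\in L_{\mathcal M}(\Omega)$ with $\rho^n>0$, let $\boldsymbol u^n\in\boldsymbol H_{\mathcal E}(\Omega)$, and let $0<\beta\le\frac12$. Suppose $\delta t>0$ is such that for each $\sigma=K|L\in\mathcal E^{(i)}_{\mathrm{int}}$, $i\in\{1,\dots,d\}$, $$\delta t\,\max\Big\{\frac{|\partial K|}{|K|},\frac{|\partial L|}{|L|}\Big\}\,|u^n_\sigma|\le\frac{\beta}{1+\beta}\,\frac{\min\{\rho^n_K,\rho^n_L\}}{\max\{\rho^n_K,\rho^n_L\}},$$ where $|\partial K|=\sum_{\sigma\in\mathcal E(K)}|\sigma|$. Then $$\frac{\delta t}{|K|}\sum_{\sigma\in\mathcal E(K)}\frac{|F_{\sigma,K}(\rho^n,\boldsymbol u^n)|}{\rho^n_K}\le\frac13\qquad\text{for all }K\in\mathcal M.$$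
   Context: Grid. $\Omega$ is a $d$-dimensional box, $d\in\{1,2,3\}$, with periodic boundary conditions (i.e. identified with the torus $\mathbb T^d$). A MAC grid $(\mathcal M,\mathcal E)$ consists of a primal mesh $\mathcal M$: a conforming, structured, possibly non-uniform partition of $\bar\Omega$ into closed axis-parallel boxes $K$ (primal cells), and the set $\mathcal E$ of their faces $\sigma$. $\mathcal E^{(i)}$ is the set of faces orthogonal to the $i$-th unit vector $\boldsymbol e^{(i)}$; $\mathcal E(K)$ is the set of faces of $K$. Because of periodicity every face is internal, $\mathcal E^{(i)}_{\mathrm{int}}=\mathcal E^{(i)}$, and each face is $\sigma=K|L$, the common face of two cells $K\ne L$. $|K|$ and $|\sigma|$ denote $d$- and $(d-1)$-dimensional measures ($|\sigma|=1$ if $d=1$). The dual cell $D_\sigma$ of $\sigma=K|L$ is the union of the halves of $K$ and $L$ adjacent to $\sigma$. $L_{\mathcal M}(\Omega)$: real functions constant on each $K\in\mathcal M$ (value $\rho_K$). $\boldsymbol H_{\mathcal E}(\Omega)$: vector fields whose $i$-th component is constant on each $D_\sigma$, $\sigma\in\mathcal E^{(i)}$ (value $u_\sigma$). Upwind mass flux. For $\sigma=K|L\in\mathcal E^{(i)}$, $F_{\sigma,K}(\rho,\boldsymbol u)=|\sigma|\{\rho_K u_{\sigma,K}^++\rho_L u_{\sigma,K}^-\}$, where $u_{\sigma,K}=u_\sigma\,\boldsymbol e^{(i)}\cdot\boldsymbol\nu_{\sigma,K}$, $\boldsymbol\nu_{\sigma,K}$ is the unit normal to $\sigma$ outward to $K$,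 $a^+=\max\{a,0\}$ and $a^-=\min\{a,0\}$. *)

(* Defs.v *)
From HB Require Import structures.
From mathcomp Require Import all_boot all_order all_algebra.
From mathcomp Require Import reals.
Set Implicit Arguments.
Unset Strict Implicit.
Unset Printing Implicit Defensive.
Import Order.TTheory GRing.Theory Num.Theory.
Local Open Scope ring_scope.

Record box (R : realType) (d : nat) := Box {
  lo : 'I_d -> R;
  hi : 'I_d -> R;
  lo_lt_hi : forall i, lo i < hi i }.

(* A conforming structured partition of a box into axis-parallel boxes is the
   product of d one-dimensional subdivisions
     lo i = vertex i 0 < vertex i 1 < ... < vertex i (ncells i) = hi i;
   the values of [vertex i] beyond [ncells i] are irrelevant. The ends lo i and
   hi i are identified by periodicity, so that every face separates two
   distinct cells exactly when each direction has at least two of them. *)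
Record mac_grid (R : realType) (d : nat) (Omega : box R d) := MacGrid {
  ncells : 'I_d -> nat;
  vertex : 'I_d -> nat -> R;
  ncells_gt1 : forall i, (1 < ncells i)%N;
  vertex_lo : forall i, vertex i 0%N = lo Omega i;
  vertex_hi : forall i, vertex i (ncells i) = hi Omega i;
  vertex_lt : forall i (k : nat), (k < ncells i)%N ->
    vertex i k < vertex i k.+1 }.

Section Mesh.
Variables (R : realType) (d : nat) (Omega : box R d) (G : mac_grid Omega).

(* The multi-index K stands for the closed box
   \prod_i [vertex i (K i), vertex i (K i).+1]. *)
Definition cell : finType := {dffun forall i : 'I_d, 'I_(ncells G i)}.

(* (i, K) stands for the face of K lying in the hyperplane
   x_i = vertex i (K i).+1, i.e. the one with normal +e_i outward to K.
   Periodicity makes this a bijective labelling of the faces. In particular,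
   when a direction has exactly two cells, their two common faces are kept
   distinct. *)
Definition face : finType := ('I_d * cell)%type.

Definition faces_dir (i : 'I_d) : {set face} := [set s | s.1 == i].

(* [ordS] is the cyclic successor. *)
Definition shift (i : 'I_d) (K : cell) : cell :=
  [ffun j : 'I_d => if j == i then ordS (K j) else K j].

(* The cells on the -e_i and on the +e_i side of a face orthogonal to e_i. *)
Definition cell_minus (s : face) : cell := s.2.
Definition cell_plus (s : face) : cell := shift s.1 s.2.

(* s = K|L *)
Definition separates (s : face) (K L : cell) : bool :=
  ((K == cell_minus s) && (L == cell_plus s)) ||
  ((K == cell_plus s) && (L == cell_minus s)).

Definition faces_of (K : cell) : {set face} :=
  [set s | (cell_minus s == K) || (cell_plus s == K)].

(* The cell L with s = K|L, for s in faces_of K. *)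
Definition other_cell (s : face) (K : cell) : cell :=
  if K == cell_minus s then cell_plus s else cell_minus s.

Definition mesh_size (i : 'I_d) (k : nat) : R := vertex G i k.+1 - vertex G i k.

Definition cell_measure (K : cell) : R := \prod_(i < d) mesh_size i (K i).

(* The empty product gives |s| = 1 when d = 1. *)
Definition face_measure (s : face) : R :=
  \prod_(j < d | j != s.1) mesh_size j (s.2 j).

Definition boundary_measure (K : cell) : R :=
  \sum_(s in faces_of K) face_measure s.

(* Piecewise constant functions are given by their values: rho K on the cell K,
   and u s for the component of u along e_i on the dual cell of a face s
   orthogonal to e_i. *)
Definition L_M : Type := cell -> R.
Definition H_E : Type := face -> R.

(* e_i . nu_{s,K}, for a face s of K orthogonal to e_i and the unit normal
   nu_{s,K} to s outward to K. *)
Definition normal_sign (s : face) (K : cell) : R :=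
  if K == cell_minus s then 1 else -1.

Definition normal_velocity (u : H_E) (s : face) (K : cell) : R :=
  u s * normal_sign s K.

Definition pos_part (a : R) : R := Num.max a 0.
(* Nonpositive, with a = pos_part a + neg_part a. *)
Definition neg_part (a : R) : R := Num.min a 0.

Definition mass_flux (rho : L_M) (u : H_E) (s : face) (K : cell) : R :=
  face_measure s *
    (rho K * pos_part (normal_velocity u s K) +
     rho (other_cell s K) * neg_part (normal_velocity u s K)).

Lemma cell_minus_neq_plus (s : face) : cell_minus s != cell_plus s.
Proof.
apply/eqP => /ffunP /(_ s.1); rewrite ffunE eqxx => /(congr1 val) /=.
case: (s.2 s.1) => k /= kn; have n1 := ncells_gt1 G s.1.
move: kn; rewrite leq_eqVlt => /orP[/eqP kn|kn]; last first.
  by rewrite modn_small // => /eqP; rewrite -[k in k == _]addn0 -addn1 eqn_add2l.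
by rewrite kn modnn => k0; move: n1; rewrite -kn k0.
Qed.

End Mesh.

(* Main.v *)
Require Import Defs.
From HB Require Import structures.
From mathcomp Require Import all_boot all_order all_algebra.
From mathcomp Require Import reals lra.
Set Implicit Arguments.
Unset Strict Implicit.
Unset Printing Implicit Defensive.
Import Order.TTheory GRing.Theory Num.Theory.
Local Open Scope ring_scope.

(* Upwinding makes |F_{s,K}| at most |s| max(rho_K, rho_L) |u_s|, and the factor
   min / max in the time step restriction absorbs max(rho_K, rho_L) / rho_K.
   Since beta / (1 + beta) <= 1 / 3, each face s contributes at most
   |s| / (3 |dK|), and these bounds add up to 1 / 3. *)

Lemma mesh_size_gt0 (R : realType) (d : nat) (Omega : box R d)
  (G : mac_grid Omega) (i : 'I_d) (K : cell G) : 0 < mesh_size G i (K i).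
Proof. by rewrite subr_gt0; apply: vertex_lt. Qed.

Lemma cell_measure_gt0 (R : realType) (d : nat) (Omega : box R d)
  (G : mac_grid Omega) (K : cell G) : 0 < cell_measure K.
Proof. by apply: prodr_gt0 => i _; apply: mesh_size_gt0. Qed.

Lemma face_measure_gt0 (R : realType) (d : nat) (Omega : box R d)
  (G : mac_grid Omega) (s : face G) : 0 < face_measure s.
Proof. by apply: prodr_gt0 => i _; apply: mesh_size_gt0. Qed.

(** With [0 < d], the face of [K] with outward normal along the first axis contributes a positive
    term; for [d = 0] the sum would be empty. *)
Lemma boundary_measure_gt0 (R : realType) (d : nat) (Omega : box R d)
  (G : mac_grid Omega) (K : cell G) : (0 < d)%N -> 0 < boundary_measure K.
Proof.
move=> d_gt0; rewrite /boundary_measure (bigD1 (Ordinal d_gt0, K)) /=; last first.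
  by rewrite inE eqxx.
apply: ltr_wpDr; last exact: face_measure_gt0.
by apply: sumr_ge0 => s _; apply/ltW/face_measure_gt0.
Qed.

Lemma separates_other_cell (R : realType) (d : nat) (Omega : box R d)
  (G : mac_grid Omega) (s : face G) (K : cell G) :
  s \in faces_of K -> separates s K (other_cell s K).
Proof.
rewrite inE /separates /other_cell [_ == K]eq_sym [cell_plus s == K]eq_sym.
by case: ifP => /= [_ _|_ ->]; rewrite eqxx.
Qed.

(** At most one of [pos_part v] and [neg_part v] is nonzero, so a single density survives and the
    bound has a maximum instead of a sum. *)
Lemma upwind_norm_le (R : realType) (a b v : R) : 0 <= a -> 0 <= b ->
  `|a * pos_part v + b * neg_part v| <= Num.max a b * `|v|.
Proof.
move=> a0 b0; rewrite /pos_part /neg_part; have [v0|v0] := leP 0 v.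
  rewrite mulr0 addr0 normrM (ger0_norm a0).
  by apply: ler_wpM2r; rewrite ?le_max ?lexx.
rewrite mulr0 add0r normrM (ger0_norm b0).
by apply: ler_wpM2r; rewrite ?le_max ?lexx ?orbT.
Qed.

Lemma mass_flux_norm_le (R : realType) (d : nat) (Omega : box R d)
  (G : mac_grid Omega) (rho : L_M G) (u : H_E G) (s : face G) (K : cell G) :
  (forall L, 0 <= rho L) ->
  `|mass_flux rho u s K|
    <= face_measure s * (Num.max (rho K) (rho (other_cell s K)) * `|u s|).
Proof.
move=> rho_ge0; have s0 := ltW (face_measure_gt0 s).
rewrite /mass_flux normrM (ger0_norm s0) ler_wpM2l //.
have -> : `|u s| = `|normal_velocity u s K|.
  by rewrite normrM /normal_sign; case: ifP; rewrite ?normrN normr1 mulr1.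
exact: upwind_norm_le.
Qed.

(** The maximum cancels against the denominator in the bound on [w], leaving [x * Num.min a b / a],
    which is at most [x]. It is applied with [a], [b] the two densities, [m] the face measure and
    [w] the left side of the time step restriction for [K]. *)
Lemma scaled_flux_le (R : realFieldType) (a b w m x : R) :
  0 < a -> 0 < b -> 0 <= x ->
  w <= x * (Num.min a b / Num.max a b) -> 0 <= m ->
  m * (Num.max a b * w) / a <= m * x.
Proof.
move=> a0 b0 x0 wle m0; have M0 : 0 < Num.max a b by rewrite lt_max a0.
rewrite -mulrA ler_wpM2l // ler_pdivrMr //.
apply: (le_trans (ler_wpM2l (ltW M0) wle)).
rewrite mulrCA [_ * (_ / _)]mulrCA divff ?gt_eqF // mulr1.
by rewrite ler_wpM2l // ge_min lexx.
Qed.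

Theorem proposition6p1 (R : realType) (d : nat) (hd : (1 <= d <= 3)%N)
  (Omega : box R d) (G : mac_grid Omega)
  (rho : L_M G) (rho_gt0 : forall K : cell G, 0 < rho K)
  (u : H_E G)
  (beta : R) (beta_gt0 : 0 < beta) (beta_le : beta <= 1 / 2)
  (dt : R) (dt_gt0 : 0 < dt)
  (cfl : forall (i : 'I_d) (s : face G) (K L : cell G),
    s \in faces_dir G i -> separates s K L ->
    dt * Num.max (boundary_measure K / cell_measure K)
                 (boundary_measure L / cell_measure L) * `|u s|
    <= beta / (1 + beta) * (Num.min (rho K) (rho L) / Num.max (rho K) (rho L))) :
  forall K : cell G,
    dt / cell_measure K * (\sum_(s in faces_of K) `|mass_flux rho u s K| / rho K)
    <= 1 / 3.
Proof.
move=> K; have C0 := cell_measure_gt0 K.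
have /andP[d_gt0 _] := hd; have B0 := boundary_measure_gt0 K d_gt0.
have x0 : 0 <= beta / (1 + beta) by rewrite divr_ge0; lra.
(* The ratio increases with [beta] and equals 1/3 at [beta = 1/2]. *)
have x_le : beta / (1 + beta) <= 1 / 3 by rewrite ler_pdivrMr; lra.
have c0 : 0 <= dt * (boundary_measure K / cell_measure K).
  by rewrite mulr_ge0 ?divr_ge0 // ltW.
(* Multiplying by [boundary_measure K] turns both sides into sums over the faces of [K], which are
   compared term by term. *)
rewrite -(ler_pM2l B0) mulrA (mulrCA _ dt) mulr_sumr [leRHS]mulr_suml.
apply: ler_sum => s sK; set L := other_cell s K.
have f0 := ltW (face_measure_gt0 s).
have us_le : dt * (boundary_measure K / cell_measure K) * `|u s|
    <= beta / (1 + beta) * (Num.min (rho K) (rho L) / Num.max (rho K) (rho L)).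
  have sd : s \in faces_dir G s.1 by rewrite inE.
  apply: (le_trans _ (cfl _ _ _ _ sd (separates_other_cell sK))).
  by rewrite ler_wpM2r // ler_wpM2l ?(ltW dt_gt0) // le_max lexx.
apply: (le_trans _ (ler_wpM2l f0 x_le)).
apply: (le_trans _ (scaled_flux_le _ _ x0 us_le f0)) => //.
(* Cancelling [rho K] and moving the factor [dt * (boundary_measure K / cell_measure K)] to the
   front on the right leaves the upwind bound on the flux. *)
rewrite [leLHS]mulrA ler_pM2r ?invr_gt0 // (mulrCA (Num.max _ _)) [leRHS]mulrCA.
apply: ler_wpM2l => //; apply: mass_flux_norm_le => M; exact: ltW.
Qed.
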